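(* Let $\alpha_c(d)$ be the critical value for Bernoulli parking on the infinite $d$-ary tree $\mathbb T_d$. It holds for all $d\ge2$ that $$\frac{1}{2e^2}\,d^{-2}\le\alpha_c(d)\le 2d^{-2}.$$
   Context: Parking process: on a tree with root $\rho$, each vertex has one parking spot. Initially (time $0$) $\eta_v$ cars arrive to each vertex $v$. Cars move towards the root in discrete time, one edge per time step. When a car arrives at an available spot it parks there and the spot becomes unavailable; if several cars arrive at the same available spot simultaneously, one chosen uniformly at random parks there and the others continue towards the root. (This applies also to the cars arriving initially at a vertex.) $X\in\{0,1,\dots\}\cup\{\infty\}$ is the total number of cars that ever arrive to $\rho$, including the $\eta_\rho$ cars initially there. $\mathbb T_d$ is the infinite rooted tree in which each vertex has $d$ children. Bernoulli parking with parameter $\alpha\in[0,2]$: the $\eta_v$ are i.i.d., equal to $2$ with probability $\alpha/2$ and $0$ otherwise (so $E\eta_v=\alpha$). $\alpha_c(d)\in(0,1)$ is the number such that, for Bernoulli parking on $\mathbb T_d$, $EX<\infty$ for $\alpha<\alpha_c(d)$ and $X=\infty$ almost surely for $\alpha>\alpha_c(d)$ (its existence is a theorem of Goldschmidt and Przykucki). *)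

(* Defs.v *)
From HB Require Import structures.
From mathcomp Require Import all_boot all_order all_algebra.
From mathcomp Require Import all_classical all_reals all_analysis.

Set Implicit Arguments.
Unset Strict Implicit.
Unset Printing Implicit Defensive.

Import Order.TTheory GRing.Theory Num.Theory.
Import numFieldNormedType.Exports.

Local Open Scope classical_set_scope.
Local Open Scope ring_scope.

(* Vertices of the infinite d-ary tree are finite words over 'I_d: the root is
   the empty word and the children of v are the words i :: v. *)
Definition vertex (d : nat) := seq 'I_d.

Definition tree_root (d : nat) : vertex d := [::].

Definition children (d : nat) (v : vertex d) : seq (vertex d) :=
  [seq i :: v | i <- enum 'I_d].

(* (v, j) is the j-th of the cars initially at v. *)
Definition car (d : nat) := (vertex d * nat)%type.

(* arriving v lists the cars arriving at v at the current time; spot v is the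
   car parked at v just before that time, if any. *)
Record parking_state (d : nat) := ParkingState {
  arriving : vertex d -> seq (car d);
  spot : vertex d -> option (car d) }.

(* Resolution of one vertex.  When k.+1 cars find the spot available, the one
   of rank c k among them parks.  The result is the list of the cars driving on
   and the new content of the spot. *)
Definition park (d : nat) (c : forall k : nat, 'I_k.+1)
    (s : seq (car d)) (p : option (car d)) : seq (car d) * option (car d) :=
  match p, s with
  | None, x :: s' =>
      let j := c (size s') in
      (take j s ++ drop j.+1 s, Some (nth x s j))
  | _, _ => (s, p)
  end.

Section Dynamics.
Variables (d : nat) (eta : vertex d -> nat)
  (tie : vertex d -> forall k : nat, 'I_k.+1).

Definition initial_state : parking_state d :=
  {| arriving := fun v => [seq (v, j) | j <- iota 0 (eta v)];
     spot := fun _ => None |}.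

(* Cars that drive on from the root leave the tree. *)
Definition parking_step (S : parking_state d) : parking_state d :=
  {| arriving := fun v =>
       flatten [seq (park (tie w) (arriving S w) (spot S w)).1
               | w <- children v];
     spot := fun v => (park (tie v) (arriving S v) (spot S v)).2 |}.

Definition parking_at (t : nat) : parking_state d :=
  iter t parking_step initial_state.

Definition root_visits (R : realType) : \bar R :=
  (\sum_(0 <= t <oo) (size (arriving (parking_at t) (tree_root d)))%:R%:E)%E.

End Dynamics.

Section Independence.
Context {disp : measure_display} {Omega : measurableType disp} {R : realType}.

Definition events_of {T : Type} (f : Omega -> T) : set (set Omega) :=
  range (fun A : set T => f @^-1` A).

Definition mutually_independent (P : probability Omega R) {I : eqType}
    (F : I -> set (set Omega)) : Prop :=
  forall (s : seq I) (A : I -> set Omega),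
    uniq s -> (forall i, i \in s -> F i (A i)) ->
    P (\bigcap_(i in [set` s]) A i) = (\prod_(i <- s) P (A i))%E.

End Independence.

(* A realization, on some probability space, of the randomness of Bernoulli
   parking: the car counts eta and the uniform tie-breaking choices tie v k,
   used if k.+1 cars compete for the spot at v, all mutually independent.
   These variables are discrete, so each carries its full discrete
   sigma-algebra. *)
Record bernoulli_parking (R : realType) (d : nat) (alpha : R) :=
    BernoulliParking {
  bp_disp : measure_display;
  bp_space : measurableType bp_disp;
  bp_prob : probability bp_space R;
  bp_eta : vertex d -> bp_space -> nat;
  bp_tie : vertex d -> forall k : nat, bp_space -> 'I_k.+1;
  bp_eta_measurable : forall v, events_of (bp_eta v) `<=` measurable;
  bp_tie_measurable : forall v k, events_of (bp_tie v k) `<=` measurable;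
  bp_eta2 : forall v,
    bp_prob [set w | bp_eta v w = 2%N] = (alpha / 2)%:E;
  bp_eta0 : forall v,
    bp_prob [set w | bp_eta v w = 0%N] = (1 - alpha / 2)%:E;
  bp_tie_uniform : forall v k (i : 'I_k.+1),
    bp_prob [set w | bp_tie v k w = i] = (k.+1%:R^-1)%:E;
  bp_independent : mutually_independent bp_prob
    (fun i : vertex d + vertex d * nat =>
       match i with
       | inl v => events_of (bp_eta v)
       | inr (v, k) => events_of (bp_tie v k)
       end) }.

Definition bp_X (R : realType) (d : nat) (alpha : R)
    (B : bernoulli_parking d alpha) (w : bp_space B) : \bar R :=
  root_visits (fun v => bp_eta v w) (fun v k => bp_tie v k w) R.

(* The law of bp_X depends only on d and alpha, so the critical value does not
   depend on the chosen realizations. *)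
Definition is_critical_value (R : realType) (d : nat)
    (B : forall alpha : R, 0 <= alpha <= 2 -> bernoulli_parking d alpha)
    (alpha_c : R) : Prop :=
  [/\ 0 < alpha_c < 1,
      forall (alpha : R) (h : 0 <= alpha <= 2), alpha < alpha_c ->
        (\int[bp_prob (B alpha h)]_w bp_X w < +oo)%E
    & forall (alpha : R) (h : 0 <= alpha <= 2), alpha_c < alpha ->
        {ae bp_prob (B alpha h), forall w, bp_X w = +oo%E}].

(* Main.v *)
Require Import Defs.
From mathcomp Require Import all_boot all_order all_algebra.
From mathcomp Require Import all_classical all_reals all_analysis.
From mathcomp Require Import zify measurable_realfun lra ring.
Set Implicit Arguments.
Unset Strict Implicit.
Unset Printing Implicit Defensive.
Import Order.TTheory GRing.Theory Num.Theory.
Import numFieldNormedType.Exports.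
Local Open Scope ring_scope.

(* The number V_n(v) of cars that visit v up to time n does not depend on the
   tie-breaking and satisfies V_{n+1}(v) = eta_v + sum_i (V_n(i v) - 1)^+ over
   the children i v of v.  Put p = alpha / 2 and b_v = [eta_v = 2].

   Upper bound, at d^2 p = 1: let S_n(v) = V_n(v) - 2 b_v.  Each child i v of v
   passes on at least sum_j b_{jiv} S_n(jiv), plus one car as soon as two of its
   own children have two cars initially.  Hence
   E S_{n+2}(v) >= d^2 p min_u E S_n(u) + d p^2, and E X is infinite.

   Lower bound, at d^2 p = 1 / (4 e^2): for z = 2 d one has E z^{V_n(v)} <= 2 by
   induction on n, since z^{(k-1)^+} <= 1 - 1/z + z^k / z and
   (1 - p + p z^2) (1 + 1/z)^d <= (1 + e^-2) e^{1/2} <= 2.  Hence E X <= 2. *)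

(** * Functions of finitely many coordinates and their iterated Bernoulli means *)

Definition depends {I : eqType} {A B : Type} (s : seq I)
    (F : (I -> A) -> B) : Prop :=
  forall b c : I -> A, {in s, b =1 c} -> F b = F c.

Lemma dependsS {I : eqType} {A B : Type} (s t : seq I) (F : (I -> A) -> B) :
  {subset s <= t} -> depends s F -> depends t F.
Proof. by move=> st sF b c bc; apply: sF => i /st; exact: bc. Qed.

Lemma depends_undup {I : eqType} {A B : Type} (s : seq I) (F : (I -> A) -> B) :
  depends s F -> depends (undup s) F.
Proof. by apply: dependsS => i; rewrite mem_undup. Qed.

Lemma depends_comp {I : eqType} {A B C : Type} (s : seq I) (F : (I -> A) -> B)
  (g : B -> C) : depends s F -> depends s (fun b => g (F b)).
Proof. by move=> sF b c /sF ->. Qed.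

Definition update {I : eqType} {A : Type} (b : I -> A) (i : I) (x : A) :
    I -> A :=
  fun j => if j == i then x else b j.

Section IteratedMean.
Context {R : realType} {I : eqType} (p : R).

(* The mean over independent Bernoulli(p) coordinates in s, the other
   coordinates being frozen to those of b. *)
Fixpoint imean (s : seq I) (F : (I -> bool) -> R) (b : I -> bool) : R :=
  if s is i :: s' then
    p * imean s' F (update b i true) + (1 - p) * imean s' F (update b i false)
  else F b.

Lemma imean_cat s t F b : imean (s ++ t) F b = imean s (imean t F) b.
Proof. by elim: s b => //= i s IH b; rewrite !IH. Qed.

Lemma imeanD s F G b :
  imean s (fun b => F b + G b) b = imean s F b + imean s G b.
Proof. by elim: s b => //= i s IH b; rewrite !IH; ring. Qed.

Lemma imean_le (p01 : 0 <= p <= 1) s F G b : (forall b, F b <= G b) ->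
  imean s F b <= imean s G b.
Proof.
move=> FG; elim: s b => //= i s IH b.
have /andP[p0 p1] := p01.
by apply: lerD; rewrite ler_wpM2l // subr_ge0.
Qed.

Lemma depends_imean (s t : seq I) (F : (I -> bool) -> R) :
  depends t F -> depends t (imean s F).
Proof.
move=> tF; elim: s => //= i s IH b c bc.
by congr (_ * _ + _ * _); apply: IH => j /bc; rewrite /update; case: eqP.
Qed.

Lemma depends_update (s : seq I) (F : (I -> bool) -> R) b i x :
  i \notin s -> depends s F ->
  F (update b i x) = F b :> R.
Proof.
move=> is_ sF; apply: sF => j js; rewrite /update.
by case: eqP is_ js => // -> /negP.
Qed.

(** Fubini by hand: the inner average over [t] sees [F] as a constant, and the outer average over
    [s] then sees [imean t G], which still depends on [t] alone, as a constant. *)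
Lemma imeanM (s t : seq I) (F G : (I -> bool) -> R) b :
  (forall i, i \in s -> i \notin t) ->
  depends s F -> depends t G ->
  imean (s ++ t) (fun b => F b * G b) b = imean s F b * imean t G b.
Proof.
move=> st sF tG.
have E1 u c : {subset u <= t} ->
    imean u (fun b => F b * G b) c = F c * imean u G c.
  elim: u c => //= i u IH c ut.
  have iu : i \notin s.
    by apply/negP => /st/negP; apply; apply: ut; rewrite mem_head.
  have ut' : {subset u <= t} by move=> j ju; apply: ut; rewrite inE ju orbT.
  by rewrite !IH // !(depends_update _ _ iu sF); ring.
have E2 u H c : depends t H -> (forall i, i \in u -> i \notin t) ->
    imean u (fun b => F b * H b) c = imean u F c * H c.
  move=> tH; elim: u c => //= i u IH c ut.
  have it : i \notin t by apply: ut; rewrite mem_head.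
  rewrite !IH; try by move=> j ju; apply: ut; rewrite inE ju orbT.
  by rewrite !(depends_update _ _ it tH); ring.
rewrite imean_cat -E2 //; last exact: depends_imean.
congr imean; apply/funext => c; exact: E1.
Qed.

End IteratedMean.

Local Open Scope classical_set_scope.

(** * Independent Bernoulli variables on a probability space *)

Record bernoulli_family {disp : measure_display} {Omega : measurableType disp}
    {R : realType} {I : eqType} (P : probability Omega R) (p : R)
    (xi : I -> Omega -> bool) : Prop := BernoulliFamily {
  bern_measurable : forall i x, measurable [set w | xi i w = x];
  bern_prob : forall i, P [set w | xi i w = true] = p%:E;
  bern_indep : forall (s : seq I) (b : I -> bool), uniq s ->
    P (\bigcap_(i in [set` s]) [set w | xi i w = b i]) =
    (\prod_(i <- s) P [set w | xi i w = b i])%E }.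

Section BernoulliFamily.
Context {disp : measure_display} {Omega : measurableType disp} {R : realType}.
Context {I : eqType} (P : probability Omega R) (p : R)
  (xi : I -> Omega -> bool).
Hypothesis xiB : bernoulli_family P p xi.
Let xi_measurable := bern_measurable xiB.

Let weight (x : bool) : R := if x then p else 1 - p.

Lemma prob_coord i x : P [set w | xi i w = x] = (weight x)%:E.
Proof.
case: x; first exact: (bern_prob xiB).
rewrite (_ : [set _ | _] = ~` [set w | xi i w = true]).
  by rewrite probability_setC // (bern_prob xiB).
by apply/seteqP; split=> w /=; [move=> ->|case: (xi i w)].
Qed.

Lemma p_itv (i : I) : 0 <= p <= 1.
Proof.
by rewrite -!lee_fin -(bern_prob xiB i) probability_le1 // measure_ge0.
Qed.

Definition cylinder (t : seq I) (b : I -> bool) : set Omega :=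
  \bigcap_(i in [set` t]) [set w | xi i w = b i].

Lemma measurable_cylinder t b : measurable (cylinder t b).
Proof. by apply: fin_bigcap_measurable. Qed.

Lemma prob_cylinder t b : uniq t ->
  P (cylinder t b) = (\prod_(i <- t) weight (b i))%:E.
Proof.
move=> ut; rewrite /cylinder (bern_indep xiB) // -prodEFin.
by apply: eq_bigr => i _; rewrite prob_coord.
Qed.

Lemma cylinder_split i t b : i \notin t ->
  cylinder t b = cylinder (i :: t) (update b i true) `|`
                 cylinder (i :: t) (update b i false).
Proof.
move=> it.
have key w x : cylinder (i :: t) (update b i x) w <->
    xi i w = x /\ cylinder t b w.
  rewrite /cylinder /=; split=> [H|[H1 H2]].
    split; first by have := H i (mem_head _ _); rewrite /= /update eqxx.
    move=> j /= jt; have /= := H j; rewrite /= inE jt orbT => /(_ isT) ->.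
    by rewrite /update; case: eqP it jt => // -> /negP.
  move=> j /=; rewrite inE /update; case: eqP => [-> //|_ /=]; exact: H2.
apply/seteqP; split=> w.
  by move=> cw; case E: (xi i w); [left|right]; apply/key.
by case=> /key[].
Qed.

Lemma cylinder_disjoint i t b :
  [disjoint cylinder (i :: t) (update b i true) &
            cylinder (i :: t) (update b i false)].
Proof.
apply/disj_setPS => w [H1 H2].
have /= := H1 i (mem_head _ _); have /= -> := H2 i (mem_head _ _).
by rewrite /update eqxx.
Qed.

(** Induction on [s]: splitting the cylinder on the value of one more coordinate moves that
    coordinate to [t]; once [s] is empty, [F] is constant on the cylinder. *)
Lemma measurable_depends_cylinder s t b (F : (I -> bool) -> R) :
  depends (s ++ t) F -> uniq (s ++ t) ->
  measurable_fun (cylinder t b) (fun w => F (xi ^~ w)).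
Proof.
elim: s t b => [|i s IH] t b /= sF ust.
  apply: (eq_measurable_fun (cst (F b))); last exact: measurable_cst.
  by move=> w; rewrite inE => cw; apply: sF => i /cw.
have it : i \notin t.
  by move: ust; rewrite mem_cat negb_or => /andP[/andP[]].
have ust' : uniq (s ++ i :: t) by rewrite (uniq_catCA s [:: i] t).
rewrite (cylinder_split b it); apply/measurable_funU;
  try exact: measurable_cylinder.
have sF' : depends (s ++ i :: t) F.
  by apply: dependsS sF => j; rewrite !(inE, mem_cat) orbCA.
by split; apply: IH.
Qed.

(* A coordinate leaves [s] by conditioning on its value, that is, by moving to
   the cylinder. *)
Lemma integral_cylinder s t b (F : (I -> bool) -> R) :
  depends (s ++ t) F -> uniq (s ++ t) -> (forall b, 0 <= F b) ->
  (\int[P]_(w in cylinder t b) (F (xi ^~ w))%:E =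
   ((\prod_(i <- t) weight (b i)) * imean p s F b)%:E)%E.
Proof.
move=> + + F0; elim: s t b => [|i s IH] t b /= sF ust.
  under eq_integral.
    move=> w; rewrite inE => cw.
    rewrite (_ : F _ = F b); last by apply: sF => i /cw.
    over.
  rewrite (integral_cst P (measurable_cylinder t b) (F b)%:E).
  rewrite mulrC EFinM; congr (_ * _)%E; exact: prob_cylinder.
have it : i \notin t.
  by move: ust; rewrite mem_cat negb_or => /andP[/andP[]].
have ust' : uniq (s ++ i :: t) by rewrite (uniq_catCA s [:: i] t).
have sF' : depends (s ++ i :: t) F.
  by apply: dependsS sF => j; rewrite !(inE, mem_cat) orbCA.
have mF := @measurable_depends_cylinder (i :: s) t b F sF ust.
rewrite (cylinder_split b it) in mF *.
rewrite (ge0_integral_setU P (measurable_cylinder _ _) (measurable_cylinder _ _)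
  _ _ (cylinder_disjoint i t b)); last 2 first.
- exact/measurable_EFinP.
- by move=> w _; rewrite lee_fin.
rewrite !IH // !big_cons -EFinD; congr EFin.
have wt x : \prod_(j <- t) weight (update b i x j) =
    \prod_(j <- t) weight (b j).
  by apply: eq_big_seq => j jt; rewrite /update; case: eqP it jt => // -> /negP.
by rewrite !wt /update eqxx /=; ring.
Qed.

Lemma cylinder0 b : cylinder [::] b = setT.
Proof. by rewrite /cylinder set_nil bigcap_set0. Qed.

Lemma measurable_depends (s : seq I) (F : (I -> bool) -> R) : depends s F ->
  measurable_fun setT (fun w => F (xi ^~ w)).
Proof.
move=> /depends_undup sF; rewrite -(cylinder0 xpredT).
by apply: (@measurable_depends_cylinder (undup s)); rewrite cats0 ?undup_uniq.
Qed.

(** Taking [fine] is harmless for a nonnegative [F] of finitely many coordinates: its integral is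
    finite by [integral_mean]. *)
Definition mean (F : (I -> bool) -> R) : R :=
  fine (\int[P]_w (F (xi ^~ w))%:E)%E.

(** The configuration [b] is arbitrary because [s] contains every coordinate that [F] reads, and all
    of these are averaged out. *)
Lemma integral_imean (s : seq I) (F : (I -> bool) -> R) b :
  depends s F -> uniq s -> (forall b, 0 <= F b) ->
  (\int[P]_w (F (xi ^~ w))%:E = (imean p s F b)%:E)%E.
Proof.
move=> sF us F0.
by rewrite -(cylinder0 b) (@integral_cylinder s) ?cats0 // big_nil mul1r.
Qed.

Lemma mean_imean (s : seq I) (F : (I -> bool) -> R) b :
  depends s F -> uniq s -> (forall b, 0 <= F b) ->
  mean F = imean p s F b.
Proof. by move=> sF us F0; rewrite /mean (integral_imean b sF). Qed.

Lemma integral_mean (s : seq I) (F : (I -> bool) -> R) :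
  depends s F -> (forall b, 0 <= F b) ->
  (\int[P]_w (F (xi ^~ w))%:E = (mean F)%:E)%E.
Proof.
move=> sF F0; have sF' := depends_undup sF.
rewrite (mean_imean xpredT sF') ?undup_uniq//.
by apply: integral_imean; rewrite ?undup_uniq.
Qed.

Lemma mean_cst c : 0 <= c -> mean (fun=> c) = c.
Proof. by move=> c0; rewrite (@mean_imean [::] _ xpredT). Qed.

Lemma mean_ge0 (F : (I -> bool) -> R) : (forall b, 0 <= F b) -> 0 <= mean F.
Proof.
by move=> F0; apply/fine_ge0/integral_ge0 => w _; rewrite lee_fin.
Qed.

Lemma meanD (s : seq I) (F G : (I -> bool) -> R) :
  depends s F -> depends s G ->
  (forall b, 0 <= F b) -> (forall b, 0 <= G b) ->
  mean (fun b => F b + G b) = mean F + mean G.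
Proof.
move=> sF sG F0 G0.
have sFG : depends s (fun b => F b + G b).
  by move=> b c bc; rewrite (sF b c bc) (sG b c bc).
rewrite (mean_imean xpredT (depends_undup sFG)) ?undup_uniq //;
  last by move=> b; rewrite addr_ge0.
rewrite (mean_imean xpredT (depends_undup sF)) ?undup_uniq //.
by rewrite (mean_imean xpredT (depends_undup sG)) ?undup_uniq ?imeanD.
Qed.

Lemma mean_le (s : seq I) (F G : (I -> bool) -> R) :
  depends s F -> depends s G ->
  (forall b, 0 <= F b) -> (forall b, F b <= G b) -> mean F <= mean G.
Proof.
move=> sF sG F0 FG.
have G0 b : 0 <= G b by exact: le_trans (FG b).
rewrite (mean_imean xpredT (depends_undup sF)) ?undup_uniq //.
rewrite (mean_imean xpredT (depends_undup sG)) ?undup_uniq //.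
(* The bounds on [p] come from an actual index [i]; with no coordinate to average, [imean] is plain
   evaluation. *)
case: s {sF sG} => [|i s]; first exact: FG.
by apply: imean_le => //; exact: p_itv i.
Qed.

Lemma mean_sum {J : Type} s (r : seq J) (F : J -> (I -> bool) -> R) :
  (forall j, depends s (F j)) -> (forall j b, 0 <= F j b) ->
  mean (fun b => \sum_(j <- r) F j b) = \sum_(j <- r) mean (F j).
Proof.
move=> sF F0; elim: r => [|j r IH].
  rewrite big_nil -[RHS]mean_cst //; congr mean; apply/funext => b.
  by rewrite big_nil.
have sS : depends s (fun b => \sum_(k <- r) F k b).
  by move=> b c bc; apply: eq_bigr => k _; exact: sF.
rewrite big_cons -IH -(meanD (sF j) sS) // => [|b]; last exact: sumr_ge0.
by congr mean; apply/funext => b; rewrite big_cons.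
Qed.

Lemma meanM (s t : seq I) (F G : (I -> bool) -> R) :
  (forall i, i \in s -> i \notin t) ->
  depends s F -> depends t G ->
  (forall b, 0 <= F b) -> (forall b, 0 <= G b) ->
  mean (fun b => F b * G b) = mean F * mean G.
Proof.
move=> st sF tG F0 G0.
have st' i : i \in undup s -> i \notin undup t.
  by rewrite !mem_undup; exact: st.
have d : depends (undup s ++ undup t) (fun b => F b * G b).
  move=> b c bc; congr (_ * _); [apply: sF|apply: tG] => i ii; apply: bc.
    by rewrite mem_cat mem_undup ii.
  by rewrite mem_cat !mem_undup ii orbT.
rewrite (mean_imean xpredT (depends_undup sF)) ?undup_uniq //.
rewrite (mean_imean xpredT (depends_undup tG)) ?undup_uniq //.
rewrite (mean_imean xpredT d) //.
- by apply: imeanM => //; exact: depends_undup.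
- rewrite cat_uniq !undup_uniq andbT /= -all_predC; apply/allP => i it /=.
  by apply/negP => /st'; rewrite it.
- by move=> b; rewrite mulr_ge0.
Qed.

Lemma mean_prod {J : eqType} (r : seq J) (s : J -> seq I)
    (F : J -> (I -> bool) -> R) :
  (forall j, depends (s j) (F j)) -> (forall j b, 0 <= F j b) ->
  (forall j k i, j != k -> i \in s j -> i \notin s k) -> uniq r ->
  mean (fun b => \prod_(j <- r) F j b) = \prod_(j <- r) mean (F j).
Proof.
move=> sF F0 sD; elim: r => [_|j r IH /= /andP[jr ur]].
  rewrite big_nil -[RHS]mean_cst //; congr mean; apply/funext => b.
  by rewrite big_nil.
have sP : depends (flatten [seq s k | k <- r]) (fun b => \prod_(k <- r) F k b).
  move=> b c bc; apply: eq_big_seq => k kr; apply: sF => i ik; apply: bc.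
  by apply/flatten_mapP; exists k.
rewrite big_cons -IH // -(meanM _ (sF j) sP) // => [|i ij|b]; last 2 first.
- apply/negP => /flatten_mapP[k kr]; apply/negP; apply: sD ij.
  by apply: contraNneq jr => ->.
- by apply: prodr_ge0.
by congr mean; apply/funext => b; rewrite big_cons.
Qed.

Lemma mean_coord i (f : bool -> R) : (forall x, 0 <= f x) ->
  mean (fun b => f (b i)) = p * f true + (1 - p) * f false.
Proof.
move=> f0; rewrite (@mean_imean [:: i] _ xpredT) //=; last first.
  by move=> b c bc; rewrite bc // mem_head.
by rewrite /update eqxx.
Qed.

End BernoulliFamily.

(** * Visit counts and their relation to the parking dynamics *)

Section Visits.
Variable d : nat.
Implicit Types (v : vertex d) (eta : vertex d -> nat) (n : nat).

(** The truncated predecessor is $(k-1)^+$: one visitor, if there is any, stays at the child.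
    Driving one edge takes one time step, hence the shift of [n]. *)
Fixpoint visits eta n v : nat :=
  (if n is m.+1 then eta v + \sum_(i < d) (visits eta m (i :: v)).-1
   else eta v)%N.

Lemma visits_le eta eta' n v : (forall u, eta u <= eta' u)%N ->
  (visits eta n v <= visits eta' n v)%N.
Proof.
move=> le; elim: n v => [|n IH] v //=.
apply: leq_add => //; apply: leq_sum => i _.
by rewrite -!subn1 leq_sub2r.
Qed.

Lemma visits_mono eta v : {homo visits eta ^~ v : m n / (m <= n)%N}.
Proof.
apply: homo_leq => [n|k m n|n]; [exact: leqnn|exact: leq_trans|].
elim: n v => [|n IH] v /=; first exact: leq_addr.
by rewrite leq_add2l; apply: leq_sum => i _; rewrite -!subn1 leq_sub2r.
Qed.

Lemma eq_visits eta eta' n v : eta =1 eta' -> visits eta n v = visits eta' n v.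
Proof. by move=> /funext ->. Qed.

(** The finitely many vertices that [visits eta n v] reads. As [v] comes first, [behead] leaves
    strict descendants, on which the cars coming from below depend. *)
Fixpoint subtree n v : seq (vertex d) :=
  v :: (if n is m.+1 then flatten [seq subtree m (i :: v) | i <- enum 'I_d]
        else [::]).

Lemma mem_subtree n v : v \in subtree n v.
Proof. by case: n => [|n]; exact: mem_head. Qed.

Lemma subtreeS n i v : {subset subtree n (i :: v) <= subtree n.+1 v}.
Proof.
move=> u ui; rewrite inE; apply/orP; right.
by apply/flatten_mapP; exists i; rewrite ?mem_enum.
Qed.

Lemma subtree_suffix n v u : u \in subtree n v -> suffix v u.
Proof.
elim: n v => [|n IH] v /=; first by rewrite inE => /eqP ->; exact: suffix_refl.
rewrite inE => /orP[/eqP ->|/flatten_mapP[i _ /IH]]; first exact: suffix_refl.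
exact/suffix_trans/suffix_cons.
Qed.

(** Descendants of a vertex are words ending in it, and a word has only one suffix of each length.
    This yields independence between siblings. *)
Lemma subtree_disjoint m n (i j : 'I_d) v u : i != j ->
  u \in subtree m (i :: v) -> u \notin subtree n (j :: v).
Proof.
move=> ij /subtree_suffix /suffixP[s ->]; apply/negP => /subtree_suffix.
rewrite (suffix_catl [::] s (_ : size (j :: v) = size (i :: v))) //.
by rewrite eqseq_cons eq_sym (negbTE ij).
Qed.

Lemma subtree_notin n (i : 'I_d) v : v \notin subtree n (i :: v).
Proof. by apply/negP => /subtree_suffix/size_suffix /=; rewrite ltnn. Qed.

Lemma depends_visits (f : bool -> nat) n v :
  depends (subtree n v) (fun b => visits (fun u => f (b u)) n v).
Proof.
elim: n v => [|n IH] v b c bc /=; first by rewrite bc ?mem_head.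
rewrite bc ?mem_head //; congr (_ + _)%N; apply: eq_bigr => i _.
congr _.-1; apply: IH => u ui; apply: bc; rewrite inE; apply/orP; right.
by apply/flatten_mapP; exists i; rewrite ?mem_enum.
Qed.

Section Dynamics.
Variables (eta : vertex d -> nat) (tie : vertex d -> forall k : nat, 'I_k.+1).
Let A t v := arriving (parking_at eta tie t) v.
Let S t v := spot (parking_at eta tie t) v.

(** Tie-breaking drops out here: whichever car wins, a free spot retains exactly one. Truncated
    subtraction covers the case of no arrivals. *)
Lemma size_park (c : forall k : nat, 'I_k.+1) (s : seq (car d)) o :
  size (park c s o).1 = (size s - (o == None))%N.
Proof.
case: o s => [x|] [|y s] //=; rewrite ?subn0 //.
rewrite size_cat size_take size_drop /=; have := ltn_ord (c (size s)).
by case: ifP; lia.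
Qed.

Lemma spot_parked t v : (S t v == None) = (\sum_(s < t) size (A s v) == 0)%N.
Proof.
elim: t => [|t IH]; first by rewrite big_ord0.
rewrite big_ord_recr /= addn_eq0 -IH /S /= -/(A t v) -/(S t v).
by case: (S t v) (A t v) => [x|] [|y s].
Qed.

(** Only one car is ever withheld, at the first time with an arrival, since by [spot_parked] the
    spot is free exactly as long as nothing has come. *)
Lemma departures t v :
  (\sum_(s < t.+1) size (park (tie v) (A s v) (S s v)).1 =
   (\sum_(s < t.+1) size (A s v)).-1)%N.
Proof.
under eq_bigr do rewrite size_park spot_parked.
elim: t => [|t IH]; first by rewrite !big_ord1 big_ord0 subn1.
rewrite big_ord_recr IH -/(A _ _) [in RHS]big_ord_recr /=.
by case: eqP => /=; lia.
Qed.

(** Arrivals at time $s+1$ are the departures from the children at time $s$. Splitting off time 0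
    and exchanging the sums over times and children gives the recursion of [visits]. *)
Lemma sum_arriving t v : (\sum_(s < t.+1) size (A s v) = visits eta t v)%N.
Proof.
elim: t v => [|t IH] v; first by rewrite big_ord1 /A /= size_map size_iota.
rewrite big_ord_recl {1}/A /= size_map size_iota; congr addn.
under eq_bigr => s _.
  rewrite /A /= size_flatten /shape -map_comp -map_comp sumnE big_map /=.
  rewrite big_enum /=; over.
rewrite exchange_big /=; apply: eq_bigr => i _.
by rewrite -IH -departures.
Qed.

Lemma visits_le_root_visits (R : realType) n :
  ((visits eta n (tree_root d))%:R%:E <= root_visits eta tie R)%E.
Proof.
rewrite /root_visits -sum_arriving.
apply: le_trans (nneseries_lim_ge n.+1 _) => [|k _ _]; last by rewrite lee_fin.
by rewrite sumEFin big_mkord -natr_sum.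
Qed.

Lemma cvg_visits (R : realType) :
  (visits eta n (tree_root d))%:R%:E @[n --> \oo] --> root_visits eta tie R.
Proof.
pose u t : \bar R := (size (A t (tree_root d)))%:R%:E.
have /cvg_ex[l ul] : cvgn (fun n => \sum_(0 <= t < n) u t)%E.
  by apply: is_cvg_nneseries => t _ _; rewrite lee_fin.
rewrite /root_visits (cvg_lim _ ul) //.
(* [visits eta n] is the partial sum over the $n+1$ times $0,\dots,n$, so the sequence of partial
   sums is shifted by one. *)
move: ul; rewrite -cvg_shiftS; apply: cvg_trans; apply: near_eq_cvg.
by apply: nearW => n; rewrite -sum_arriving natr_sum -sumEFin; exact: big_mkord.
Qed.

End Dynamics.
End Visits.

(** This is $S_n(v)$, the part of the visits that comes from below; it is independent of the initial
    cars at [v]. *)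
Definition inflow d (eta : vertex d -> nat) n v : nat :=
  (if n is m.+1 then \sum_(i < d) (visits eta m (i :: v)).-1 else 0)%N.

Lemma visitsE d (eta : vertex d -> nat) n v :
  visits eta n v = (eta v + inflow eta n v)%N.
Proof. by case: n => //=; rewrite addn0. Qed.

Lemma depends_inflow d (f : bool -> nat) n (v : vertex d) :
  depends (behead (subtree n v)) (fun b => inflow (fun u => f (b u)) n v).
Proof.
case: n => [|n] b c bc //=; apply: eq_bigr => i _; congr _.-1.
apply: depends_visits => u ui; apply: bc.
by apply/flatten_mapP; exists i; rewrite ?mem_enum.
Qed.

(** Let [w] be a child of [v]. A child of [w] starting with two cars keeps one and sends on one more
    than its inflow, so [w] receives at least $B+C$ cars. If $B \ge 1$, then [w] passes on at least
    $C+(B-1)$, and $B-1$ is at least 1 when both selected children have cars. *)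
Lemma inflow_two_levels d (i0 i1 : 'I_d) (b : vertex d -> bool) n v :
  i0 != i1 ->
  (\sum_(i < d) (\sum_(j < d) b (j :: i :: v)
        * inflow (fun u => (b u).*2) n (j :: i :: v)
      + b (i0 :: i :: v) * b (i1 :: i :: v))
   <= inflow (fun u => (b u).*2) n.+2 v)%N.
Proof.
move=> i01 /=; apply: leq_sum => i _; set w := i :: v.
pose X := fun j : 'I_d => inflow (fun u => (b u).*2) n (j :: w).
pose B := (\sum_(j < d) b (j :: w))%N.
pose C := (\sum_(j < d) b (j :: w) * X j)%N.
have BC : (B + C <= \sum_(j < d) (visits (fun u => (b u).*2) n (j :: w)).-1)%N.
  rewrite -big_split /=; apply: leq_sum => j _; rewrite visitsE -/(X j).
  by case: (b _) => /=; lia.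
have bB : (b (i0 :: w) + b (i1 :: w) <= B)%N.
  by rewrite /B (bigD1 i0) //= (bigD1 i1) 1?eq_sym //= addnA leq_addr.
(* With $B=0$ the bound $B+C-1$ could fall short of $C$, but then $C$ vanishes too. *)
have C0 : B = 0%N -> C = 0%N.
  move/eqP; rewrite sum_nat_eq0 => /forallP B0; apply: big1 => j _.
  by have /eqP -> := B0 j.
rewrite -[X in (X + _ <= _)%N]/C; case: (B) bB BC C0 => [|m].
  by case: (b (i0 :: w)) => //= _ _ ->.
by case: (b (i0 :: w)) (b (i1 :: w)) => [] [] /=; lia.
Qed.

(** * Moment bounds on the Bernoulli tree *)

Section BernoulliTree.
Context {disp : measure_display} {Omega : measurableType disp} {R : realType}.
Context {d : nat} (P : probability Omega R) (p : R)
  (xi : vertex d -> Omega -> bool).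
Hypothesis xiB : bernoulli_family P p xi.
Local Notation config := (vertex d -> bool).

(** Two generations multiply the previous bound by $d^2p \ge 1$ and add $dp^2$, so the mean grows at
    least linearly. The bound holds at every [v] because the induction uses it at all
    grandchildren. *)
Lemma mean_inflow_ge (i0 i1 : 'I_d) n v : i0 != i1 -> 1 <= d%:R ^+ 2 * p ->
  n%:R * (d%:R * p ^+ 2) <=
  mean P xi (fun b : config => (inflow (fun u => (b u).*2) n.*2 v)%:R).
Proof.
move=> i01 dp; have /andP[p0 p1] := p_itv xiB v.
have coord u : mean P xi (fun b : config => (b u)%:R) = p.
  rewrite (mean_coord xiB u (f := fun x => x%:R)) //.
  by rewrite mulr1 mulr0 addr0.
have c0 : 0 <= d%:R * p ^+ 2 by rewrite mulr_ge0 ?ler0n ?exprn_ge0.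
elim: n v => [|n IH] v.
  rewrite mul0r (mean_cst xiB) //.
pose T (b : vertex d -> bool) u : nat := inflow (fun u => (b u).*2) n.*2 u.
pose L (b : vertex d -> bool) : R :=
  \sum_(i < d) (\sum_(j < d) (b (j :: i :: v))%:R * (T b (j :: i :: v))%:R
    + (b (i0 :: i :: v))%:R * (b (i1 :: i :: v))%:R).
have dT u : depends (behead (subtree n.*2 u))
    (fun b : config => (T b u)%:R : R).
  by move=> b c /(@depends_inflow d double) bc; congr _%:R.
have dbT u : depends (subtree n.*2 u)
    (fun b : config => (b u)%:R * (T b u)%:R : R).
  move=> b c bc; rewrite (dT u b c) ?bc ?mem_head //.
    exact: mem_subtree.
  by move=> x ux; apply: bc; apply: mem_behead.
(* The product splits because [T b u] reads only strict descendants of [u]. *)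
have bT u : mean P xi (fun b : config => (b u)%:R * (T b u)%:R) =
    p * mean P xi (fun b : config => (T b u)%:R).
  rewrite -(coord u); apply: (meanM xiB (s := [:: u])
     (t := behead (subtree n.*2 u))).
  - move=> x; rewrite inE => /eqP ->; case: (n.*2) => [|m] //=.
    by apply/negP => /flatten_mapP[i _]; apply/negP; exact: subtree_notin.
  - by move=> b c bc; rewrite bc ?mem_head.
  - exact: dT.
  - by move=> b; exact: ler0n.
  - by move=> b; exact: ler0n.
have bb u w : u != w ->
    mean P xi (fun b : config => (b u)%:R * (b w)%:R) = p * p.
  move=> uw; rewrite -{1}(coord u) -(coord w).
  apply: (meanM xiB (s := [:: u]) (t := [:: w])).
  - by move=> x; rewrite !inE => /eqP ->.
  - by move=> b c bc; rewrite bc ?mem_head.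
  - by move=> b c bc; rewrite bc ?mem_head.
  - by move=> b; exact: ler0n.
  - by move=> b; exact: ler0n.
pose D := subtree n.*2.+2 v.
have DS i j : {subset subtree n.*2 (j :: i :: v) <= D}.
  by move=> u uij; apply: (@subtreeS _ _ i); exact: (@subtreeS _ _ j).
have Dh i j : (j :: i :: v) \in D by apply: (DS i j); exact: mem_subtree.
have Dbb u w : u \in D -> w \in D ->
    depends D (fun b : config => (b u)%:R * (b w)%:R : R).
  by move=> uD wD b c bc; rewrite !bc.
have DbT i j :
    depends D (fun b : config =>
      (b (j :: i :: v))%:R * (T b (j :: i :: v))%:R : R).
  exact: dependsS (dbT _).
have DsT i : depends D (fun b : config =>
    \sum_(j < d) (b (j :: i :: v))%:R * (T b (j :: i :: v))%:R : R).
  by move=> b c bc; apply: eq_bigr => j _; exact: DbT.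
have LE : mean P xi L =
    \sum_(i < d) (\sum_(j < d) p * mean P xi (fun b : config =>
      (T b (j :: i :: v))%:R) + p * p).
  rewrite (mean_sum xiB (s := D)) => [|i b c bc|i b].
  - apply: eq_bigr => i _.
    rewrite (meanD xiB (DsT i) (Dbb _ _ (Dh _ _) (Dh _ _))).
    + rewrite bb ?eqseq_cons ?(negbTE i01) //; congr (_ + _).
      rewrite (mean_sum xiB (s := D)) //.
      by apply: eq_bigr => j _; exact: bT.
    + by move=> b; apply: sumr_ge0 => j _; rewrite mulr_ge0.
    + by move=> b; rewrite mulr_ge0.
  - by rewrite (DsT i b c) // (Dbb _ _ (Dh _ _) (Dh _ _) b c).
  - by rewrite addr_ge0 ?mulr_ge0 // sumr_ge0 // => j _; rewrite mulr_ge0.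
have: mean P xi L <= mean P xi (fun b : config =>
    (inflow (fun u => (b u).*2) n.*2.+2 v)%:R).
  apply: (mean_le xiB (s := D)).
  - move=> b c bc; apply: eq_bigr => i _.
    by rewrite (DsT i b c) // (Dbb _ _ (Dh _ _) (Dh _ _) b c).
  - move=> b c bc; congr _%:R.
    by apply: (@depends_inflow d double) => u /mem_behead; exact: bc.
  - move=> b; apply: sumr_ge0 => i _.
    by rewrite addr_ge0 ?mulr_ge0 // sumr_ge0 // => j _; rewrite mulr_ge0.
  - move=> b; apply: le_trans (_ : _ <= _%:R) _; last first.
      by rewrite ler_nat; exact: (inflow_two_levels (i0 := i0) (i1 := i1)).
    rewrite natr_sum ler_sum // => i _; rewrite natrD natrM lerD2r natr_sum.
    by rewrite ler_sum // => j _; rewrite natrM.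
apply: le_trans; rewrite LE.
have: \sum_(i < d) (\sum_(j < d) p * (n%:R * (d%:R * p ^+ 2)) + p * p) <=
    mean P xi L.
  rewrite LE; apply: ler_sum => i _; rewrite lerD2r; apply: ler_sum => j _.
  by rewrite ler_wpM2l //; exact: IH.
rewrite LE; apply: le_trans.
have sumE (x : R) : \sum_(i < d) x = d%:R * x.
  by rewrite sumr_const card_ord mulr_natl.
rewrite !sumE -[n.+1]addn1 natrD -subr_ge0.
(* What remains is the surplus $(d^2p-1)\,n\,dp^2$, nonnegative by [dp]. *)
have -> : forall D N : R, D * (D * (p * (N * (D * p ^+ 2))) + p * p)
    - (N + 1%:R) * (D * p ^+ 2) = (D ^+ 2 * p - 1) * (N * (D * p ^+ 2)).
  by move=> *; ring.
by rewrite mulr_ge0 ?subr_ge0 // mulr_ge0.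
Qed.

(** The initial cars at [v] and the subtrees of its children are independent, so the exponential
    moment factors into $1-p+pz^2$ and $d$ factors [pred_le]. The assumption on [z] says exactly
    that the bound 2 reproduces itself. *)
Lemma mean_exp_visits_le (z : R) n v : 1 <= z ->
  (p * z ^+ 2 + (1 - p)) * (1 + z^-1) ^+ d <= 2 ->
  mean P xi (fun b : config => z ^+ visits (fun u => (b u).*2) n v) <= 2.
Proof.
move=> z1 zp; have /andP[p0 p1] := p_itv xiB v.
have z0 : 0 <= z by exact: le_trans z1.
have z_gt0 : 0 < z by exact: lt_le_trans z1.
have q0 : 0 <= p * z ^+ 2 + (1 - p).
  by rewrite addr_ge0 ?mulr_ge0 ?exprn_ge0 // subr_ge0.
have coord u : mean P xi (fun b : config => z ^+ (b u).*2) =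
    p * z ^+ 2 + (1 - p).
  rewrite (mean_coord xiB u
    (f := fun x => z ^+ x.*2)) => [|x]; last exact: exprn_ge0.
  by rewrite expr0 mulr1.
elim: n v => [|n IH] v /=.
  rewrite coord; apply: le_trans zp; rewrite ler_peMr // exprn_ege1 //.
  by rewrite lerDl invr_ge0.
pose V (b : vertex d -> bool) u := visits (fun u => (b u).*2) n u.
have sV u : depends (subtree n u) (fun b : config => z ^+ (V b u) : R).
  by move=> b c bc; congr (z ^+ _); apply: (@depends_visits d double).
have sV' u : depends (subtree n u) (fun b : config => z ^+ (V b u).-1 : R).
  by move=> b c bc; congr (z ^+ _.-1); apply: (@depends_visits d double).
(* From $z^{(k-1)^+} \le 1-1/z+z^k/z$ and the induction hypothesis: $1-1/z+2/z = 1+1/z$. *)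
have pred_le u : mean P xi (fun b : config => z ^+ (V b u).-1) <= 1 + z^-1.
  have s1 : depends (subtree n u)
      (fun b : config => z^-1 * z ^+ V b u : R).
    by move=> b c bc; rewrite (sV u b c).
  have s2 : depends (subtree n u)
      (fun b : config => (1 - z^-1) + z^-1 * z ^+ V b u : R).
    by move=> b c bc; rewrite (sV u b c).
  have z1' : 0 <= 1 - z^-1 by rewrite subr_ge0 invf_le1.
  apply: le_trans (mean_le xiB (sV' u) s2 _ _) _.
  - by move=> b; exact: exprn_ge0.
  - move=> b; case: (V b u) => [|k] /=; first by rewrite expr0 mulr1 subrK.
    by rewrite exprS mulKf ?gt_eqF // lerDr.
  rewrite (meanD xiB (s := subtree n u)) //; last first.
    by move=> b; rewrite mulr_ge0 ?invr_ge0 ?exprn_ge0.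
  rewrite (mean_cst xiB) //.
  rewrite (meanM xiB (s := [::]) (t := subtree n u)) //;
    last 2 first.
  - by move=> b; rewrite invr_ge0.
  - by move=> b; rewrite exprn_ge0.
  rewrite (mean_cst xiB) ?invr_ge0 //.
  have := ler_wpM2l (_ : 0 <= z^-1) (IH u); rewrite invr_ge0 => /(_ z0).
  by rewrite -/(V _ u); lra.
pose W (b : config) : R :=
  \prod_(i <- enum 'I_d) z ^+ (V b (i :: v)).-1.
have sW : depends (flatten [seq subtree n (i :: v) | i <- enum 'I_d]) W.
  move=> b c bc; apply: eq_big_seq => i ii; apply: sV' => u ui; apply: bc.
  by apply/flatten_mapP; exists i.
have -> : (fun b : config =>
    z ^+ ((b v).*2 + \sum_(i < d) (visits (fun u => (b u).*2) n (i :: v)).-1))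
    = (fun b : config => z ^+ (b v).*2 * W b).
  apply/funext => b; rewrite exprD; congr (_ * _).
  by rewrite /W big_enum /= (big_morph _ (exprD z) (expr0 z)).
rewrite (meanM xiB (s := [:: v]) _ _ sW) //.
- rewrite coord; apply: le_trans zp; apply: ler_wpM2l => //.
  rewrite (mean_prod xiB (s := fun i => subtree n (i :: v))).
  + rewrite big_enum /= -[d in _ ^+ d]card_ord -prodr_const.
    apply: ler_prod => i _; rewrite pred_le andbT.
    by apply: mean_ge0 => b; exact: exprn_ge0.
  + by move=> i; exact: sV'.
  + by move=> i b; exact: exprn_ge0.
  + by move=> i j u; exact: subtree_disjoint.
  + exact: enum_uniq.
- move=> u; rewrite inE => /eqP ->; apply/negP => /flatten_mapP[i _].
  by apply/negP; exact: subtree_notin.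
- by move=> b c bc; rewrite bc ?mem_head.
- by move=> b; exact: exprn_ge0.
- by move=> b; apply: prodr_ge0 => i _; exact: exprn_ge0.
Qed.

End BernoulliTree.

(** * Transfer to a realization of Bernoulli parking *)

Section Realization.
Context {R : realType} {d : nat} {alpha : R} (B : bernoulli_parking d alpha).
Local Notation config := (vertex d -> bool).
Let P := bp_prob B.
Let two_cars (v : vertex d) (w : bp_space B) : bool := bp_eta v w == 2%N.
Let X (eta : bp_space B -> vertex d -> nat) n w : \bar R :=
  (visits (eta w) n (tree_root d))%:R%:E.

Lemma two_cars_event v x :
  events_of (@bp_eta _ _ _ B v) [set w | two_cars v w = x].
Proof. by exists [set k | (k == 2%N) = x]. Qed.

Lemma measurable_two_cars v x : measurable [set w | two_cars v w = x].
Proof. exact/bp_eta_measurable/two_cars_event. Qed.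

Lemma prob_two_cars v : P [set w | two_cars v w = true] = (alpha / 2)%:E.
Proof.
rewrite -(bp_eta2 B v); congr (P _).
by apply/seteqP; split=> w /= /eqP.
Qed.

Lemma indep_two_cars (s : seq (vertex d)) (b : vertex d -> bool) : uniq s ->
  P (\bigcap_(v in [set` s]) [set w | two_cars v w = b v]) =
  (\prod_(v <- s) P [set w | two_cars v w = b v])%E.
Proof.
move=> us.
(* Only indices [inl v] enter the list; [setT] is a placeholder at the tie-breaking indices. *)
pose E (i : vertex d + vertex d * nat) : set (bp_space B) :=
  if i is inl v then [set w | two_cars v w = b v] else setT.
have := @bp_independent _ _ _ B [seq inl v | v <- s] E.
rewrite big_map map_inj_uniq => [|u v [] //]; move=> /(_ us) <-.
  congr (P _); apply/seteqP; split=> w H i /=.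
    by move=> /mapP[v vs ->]; exact: H.
  by move=> si; apply: (H (inl i)); rewrite /= mem_map // => u v [].
by move=> _ /mapP[v _ ->]; exact: two_cars_event.
Qed.

Lemma two_cars_bernoulli : bernoulli_family P (alpha / 2) two_cars.
Proof.
split; [exact: measurable_two_cars|exact: prob_two_cars|exact: indep_two_cars].
Qed.

(** The values 2 and 0 carry mass $\alpha/2+(1-\alpha/2)=1$ at each vertex, and there are countably
    many vertices. *)
Lemma ae_bp_eta : {ae P, forall w v, bp_eta v w = (two_cars v w).*2}.
Proof.
have H v : {ae P, forall w, bp_eta v w = (two_cars v w).*2}.
  have m k : measurable [set w | @bp_eta _ _ _ B v w = k].
    by apply: bp_eta_measurable; exists [set k].
  exists (~` ([set w | @bp_eta _ _ _ B v w = 2%N] `|`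
              [set w | @bp_eta _ _ _ B v w = 0%N])); split.
  - exact/measurableC/measurableU.
  - rewrite probability_setC; last exact: measurableU.
    rewrite measureU //; last first.
      by apply/seteqP; split=> // w [/= ->].
    transitivity (1 - ((alpha / 2)%:E + (1 - alpha / 2)%:E))%E.
      by congr (1 - (_ + _))%E; [exact: bp_eta2|exact: bp_eta0].
    by rewrite -EFinD subrKC subrr.
  - by move=> w /=; apply: contra_not => -[]; rewrite /two_cars => ->.
(* An enumeration of the vertices; codes of no vertex default to the root. *)
pose u n : vertex d := odflt [::] (unpickle n).
have : {ae P, forall w, forall n, bp_eta (u n) w = (two_cars (u n) w).*2}.
  by apply: ae_foralln => n; exact: H.
by apply: filterS => w h v; have := h (pickle v); rewrite /u pickleK.
Qed.

Lemma measurable_visits n v :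
  measurable_fun setT
    (fun w => (visits (fun u => @bp_eta _ _ _ B u w) n v)%:R : R).
Proof.
have meta u : measurable_fun setT (fun w => (@bp_eta _ _ _ B u w)%:R : R).
  move=> _ Y mY; rewrite setTI; apply: (bp_eta_measurable (v := u)).
  by exists [set k | Y k%:R].
elim: n v => [|n IH] v //=.
(* In the reals the truncated predecessor becomes $\max(x-1,0)$, to which closure properties of
   measurable functions apply. *)
rewrite (_ : (fun _ => _) = (fun w => (bp_eta v w)%:R + \sum_(i < d)
    Num.max ((visits (fun u => bp_eta u w) n (i :: v))%:R - 1) 0
    : R)); last first.
  apply/funext => w; rewrite natrD natr_sum; congr (_ + _).
  apply: eq_bigr => i _; case: visits => [|k] /=.
    by rewrite sub0r max_r // oppr_le0.
  by rewrite -natr1 addrK max_l.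
apply: measurable_funD => //; apply: measurable_sum => i.
apply: measurable_maxr => //; apply: measurable_funB => //.
Qed.

Lemma bp_X_lim w : bp_X w = limn (X (fun w v => bp_eta v w) ^~ w).
Proof. by apply/esym/cvg_lim => //; exact: cvg_visits. Qed.

Lemma measurable_bp_X : measurable_fun setT (@bp_X _ _ _ B).
Proof.
apply: (@emeasurable_fun_cvg _ _ _ _ (X (fun w v => bp_eta v w))).
  by move=> n; apply/measurable_EFinP; exact: measurable_visits.
by move=> w _; exact: cvg_visits.
Qed.

Lemma integral_bp_X_ge (i0 i1 : 'I_d) n :
  i0 != i1 -> 1 <= d%:R ^+ 2 * (alpha / 2) ->
  ((n%:R * (d%:R * (alpha / 2) ^+ 2))%:E <= \int[P]_w bp_X w)%E.
Proof.
move=> i01 dp.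
have := mean_inflow_ge two_cars_bernoulli n (tree_root d) i01 dp.
rewrite -lee_fin => /le_trans; apply.
have sI := @depends_inflow d double n.*2 (tree_root d).
have sI' : depends _ (fun b : config =>
    (inflow (fun u => (b u).*2) n.*2 (tree_root d))%:R : R) :=
  depends_comp (fun k => k%:R) sI.
rewrite -(integral_mean two_cars_bernoulli sI') //.
apply: ge0_le_integral => //.
- apply/measurable_EFinP; exact: (measurable_depends two_cars_bernoulli sI').
- exact: measurable_bp_X.
(* Twice [two_cars] is at most [bp_eta] at every point, so monotonicity of [visits] gives a
   pointwise comparison. *)
- move=> w _; apply: le_trans (visits_le_root_visits _ _ _ n.*2).
  rewrite lee_fin ler_nat.
  apply: (@leq_trans (visits (fun u => (two_cars u w).*2) n.*2 (tree_root d))).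
    by rewrite visitsE leq_addl.
  by apply: visits_le => u; rewrite /two_cars; case: eqP => [->|].
Qed.

(** Monotone convergence reduces the claim to the visits up to time $n$, whose mean is bounded
    through $k \le 2^k \le z^k$; this is where $z \ge 2$ enters. *)
Lemma integral_bp_X_le (z : R) : 2 <= z ->
  (alpha / 2 * z ^+ 2 + (1 - alpha / 2)) * (1 + z^-1) ^+ d <= 2 ->
  (\int[P]_w bp_X w <= 2%:E)%E.
Proof.
move=> z2 zp.
under eq_integral do rewrite bp_X_lim.
rewrite monotone_convergence //; last 3 first.
- by move=> n; apply/measurable_EFinP; exact: measurable_visits.
- by move=> n w _; rewrite lee_fin.
- by move=> w _ m n mn; rewrite lee_fin ler_nat visits_mono.
have Xle n : (\int[P]_w X (fun w v => bp_eta v w) n w <= 2%:E)%E.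
  have sV := @depends_visits d double n (tree_root d).
  have sV' : depends _ (fun b : config =>
      (visits (fun u => (b u).*2) n (tree_root d))%:R : R) :=
    depends_comp (fun k => k%:R) sV.
  have sz : depends _ (fun b : config =>
      z ^+ visits (fun u => (b u).*2) n (tree_root d) : R) :=
    depends_comp (fun k => z ^+ k) sV.
  rewrite (@ge0_ae_eq_integral _ _ _ _ _ _
    (X (fun w v => (two_cars v w).*2) n)) //.
  - rewrite (integral_mean two_cars_bernoulli sV') // lee_fin.
    apply: le_trans (mean_exp_visits_le two_cars_bernoulli n
      (tree_root d) _ zp).
      apply: (mean_le two_cars_bernoulli sV' sz) => // b.
      set k := visits _ _ _; apply: (@le_trans _ _ (2%:R ^+ k)).
        by rewrite -natrX ler_nat ltnW // ltn_expl.
      apply: lerXn2r; rewrite ?nnegrE //; lra.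
    by apply: le_trans z2; rewrite ler1n.
  - by apply/measurable_EFinP; exact: measurable_visits.
  - apply/measurable_EFinP.
    exact: (measurable_depends two_cars_bernoulli sV').
  - by move=> w _; rewrite lee_fin.
  - by move=> w _; rewrite lee_fin.
  - by apply: filterS ae_bp_eta => w h _; rewrite /X (eq_visits _ _ h).
apply: lime_le; last exact: nearW.
apply: ereal_nondecreasing_is_cvgn => m n mn; apply: ge0_le_integral => //.
- by move=> w _; rewrite lee_fin.
- by apply/measurable_EFinP; exact: measurable_visits.
- by apply/measurable_EFinP; exact: measurable_visits.
- by move=> w _; rewrite lee_fin ler_nat visits_mono.
Qed.

End Realization.

(* Numerical estimates for the lower bound *)
Local Close Scope classical_set_scope.

(** Both bounds come from $1+x \le e^x$: at $x=1/2$ for the lower one, and at $x=-1/8$ for the upper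
    one, as $e^{1/2} \le (8/7)^4 < 7/4$. *)
Lemma expR_half_bounds (R : realType) : 3 / 2 <= expR (1 / 2 : R) <= 7 / 4.
Proof.
apply/andP; split; first by have := expR_ge1Dx (1 / 2 : R); lra.
have h : 7 / 8 <= expR (- (1 / 8) : R).
  by have := expR_ge1Dx (- (1 / 8) : R); lra.
have E : expR (1 / 2 : R) * expR (- (1 / 8)) ^+ 4 = 1.
  by rewrite -expRM_natl -expRD (_ : _ + _ = 0) ?expR0 //; lra.
have h4 : (7 / 8) ^+ 4 <= expR (- (1 / 8) : R) ^+ 4.
  by apply: lerXn2r => //; rewrite nnegrE ?expR_ge0.
by have := ler_wpM2l (expR_ge0 (1 / 2 : R)) h4; rewrite E; lra.
Qed.

(** With $y=e^{1/2}$, the choice $z=2d$ gives $pz^2=y^{-4}$ and $(1+1/z)^d \le y$, so $(1+y^{-4})y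
    \le 2$ suffices. *)
Lemma subcritical_constants (R : realType) (d : nat) (p z : R) : (0 < d)%N ->
  p = 1 / (2 * expR 1 ^+ 2) * d%:R ^- 2 / 2 -> z = 2 * d%:R ->
  (p * z ^+ 2 + (1 - p)) * (1 + z^-1) ^+ d <= 2.
Proof.
move=> d0 pE zE; have D0 : 0 < d%:R :> R by rewrite ltr0n.
pose y : R := expR (1 / 2).
have /andP[y1 y2] : 3 / 2 <= y <= 7 / 4 := expR_half_bounds R.
have y0 : 0 < y by exact: expR_gt0.
have ey : expR 1 ^+ 2 = y ^+ 4 :> R.
  rewrite -[4%N]/(2 * 2)%N exprM -[y ^+ 2]expRM_natl.
  by congr (expR _ ^+ _); lra.
have p0 : 0 <= p.
  by rewrite pE ey !mulr_ge0 ?invr_ge0 ?mulr_ge0 ?exprn_ge0 // ltW.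
have pz : p * z ^+ 2 = y ^- 4.
  rewrite pE zE ey; field; rewrite !gt_eqF //.
have zd : (1 + z^-1) ^+ d <= y.
  have -> : y = expR z^-1 ^+ d.
    by rewrite -expRM_natl zE; congr expR; field; rewrite gt_eqF.
  rewrite zE; apply: lerXn2r;
    by rewrite ?nnegrE ?addr_ge0 ?invr_ge0 ?mulr_ge0 ?expR_ge0 ?expR_ge1Dx // ltW.
apply: le_trans (_ : (1 + y ^- 4) * y <= 2).
  apply: ler_pM => //.
  - have : p <= p * z ^+ 2; last by lra.
    by rewrite ler_peMr // exprn_ege1 // zE -natrM ler1n muln_gt0.
  - by rewrite exprn_ge0 // addr_ge0 // invr_ge0 zE mulr_ge0 // ltW.
  - by rewrite pz; lra.
rewrite -(ler_pM2r (_ : 0 < y ^+ 3)) ?exprn_gt0 //.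
have -> : (1 + y ^- 4) * y * y ^+ 3 = y ^+ 4 + 1 by field; rewrite gt_eqF.
suff : 1 <= (2 - y) * y ^+ 3 by rewrite exprS; lra.
(* On all of $[3/2,7/4]$ separate bounds on the factors give only $\frac14\cdot\frac{27}{8}<1$.
   Cutting at $8/5$ gives $1.35$ and $1.024$. *)
have [y3|y3] := leP y (8 / 5).
  apply: (@le_trans _ _ (2 / 5 * (3 / 2) ^+ 3)); first lra.
  by apply: ler_pM; rewrite ?lerXn2r ?nnegrE; lra.
apply: (@le_trans _ _ (1 / 4 * (8 / 5) ^+ 3)); first lra.
by apply: ler_pM; rewrite ?lerXn2r ?nnegrE; lra.
Qed.

(** * Comparison with the critical value *)

Unset Implicit Arguments.

Theorem proposition5 (R : realType) (d : nat) (hd : (2 <= d)%N)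
  (B : forall alpha : R, 0 <= alpha <= 2 -> bernoulli_parking d alpha)
  (alpha_c : R) (hc : is_critical_value B alpha_c) :
  1 / (2 * expR 1 ^+ 2) * d%:R ^- 2 <= alpha_c <= 2 * d%:R ^- 2.
Proof.
have [_ sub super] := hc.
have d0 : (0 < d)%N by exact: ltnW.
have D2 : 2 <= d%:R :> R by rewrite ler_nat.
have D0 : 0 < d%:R :> R by rewrite ltr0n.
have Dinv : d%:R ^- 2 <= 1 :> R.
  by rewrite invf_le1 ?exprn_gt0 // exprn_ege1 // ler1n.
have Dinv0 : 0 < d%:R ^- 2 :> R by rewrite invr_gt0 exprn_gt0.
apply/andP; split; rewrite leNgt; apply/negP => lt.
(* If $\alpha_c$ were below this [alpha], then $X=\infty$ almost surely, against $EX \le 2$. *)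
- set alpha := _ * _ in lt.
  have h : 0 <= alpha <= 2.
    have e2 : 1 <= expR 1 ^+ 2 :> R.
      by rewrite exprn_ege1 // (le_trans _ (expR_ge1Dx 1)) // lerDl.
    have i1 : 1 / (2 * expR 1 ^+ 2) <= 1 :> R.
      by rewrite div1r invf_le1; lra.
    have i0 : 0 <= 1 / (2 * expR 1 ^+ 2) :> R.
      by rewrite div1r invr_ge0; lra.
    apply/andP; split; first by apply: mulr_ge0 => //; exact: ltW.
    by apply: (@le_trans _ _ (1 * 1)); [apply: ler_pM => //; exact: ltW|lra].
  have le2 := integral_bp_X_le (B alpha h) (z := 2 * d%:R) _
    (subcritical_constants d0 erefl erefl).
  have {le2} := le2 _; rewrite (_ : 2 <= 2 * d%:R) => [/(_ isT)|]; last by lra.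
  rewrite (@ae_eq_integral _ _ _ _ _ (cst +oo%E)) //.
  + rewrite integral_cst //.
    suff -> : (+oo * bp_prob (B alpha h) setT = +oo)%E by rewrite leye_eq.
    rewrite -[RHS]mule1; congr (_ * _)%E; exact: probability_setT.
  + exact: measurable_bp_X.
  + by apply: filterS (super alpha h lt) => w.
(* If $\alpha_c$ were above this [alpha], where $d^2\alpha/2=1$, then $EX$ would be finite, yet it
   is at least $nc$ for every $n$. *)
- set alpha := _ * _ in lt.
  have h : 0 <= alpha <= 2.
    by apply/andP; split; [apply: mulr_ge0; rewrite ?ltW|rewrite /alpha; lra].
  have := sub alpha h lt.
  have i01 : Ordinal d0 != Ordinal hd by [].
  have dp : 1 <= d%:R ^+ 2 * (alpha / 2).
    rewrite (_ : _ * _ = 1) // /alpha; field; rewrite gt_eqF //.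
  have := integral_bp_X_ge (B alpha h) _ i01 dp.
  set c := _ * _ ^+ 2; set J := (integral _ _ _).
  have c0 : 0 < c.
    by rewrite mulr_gt0 // exprn_gt0 // divr_gt0 // mulr_gt0.
  case: J => [x| |] // ge _; last by have := ge 0%N.
  (* The first integer above $x/c$ already makes $nc$ exceed $x$. *)
  have := ge (Num.truncn (x / c)).+1.
  rewrite lee_fin leNgt => /negP; apply.
  by rewrite -ltr_pdivrMr //; exact: truncnS_gt.
Qed.
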